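(* (i) For any $k=1,2,\ldots$ there exists a nontrivial left $\mathfrak A_1$-module $M$ such that $\dim M=k$ (dimension over $\overline{K}_c$), that is, $d(M)=0$. (ii) Let $M$ be a finitely generated left $\mathfrak A_1$-module with a good filtration. Suppose that there exists a ''vacuum vector'' $v\in M$ such that $d_sv=0$ and $\tau^m(v)\neq 0$ for all $m=0,1,2,\ldots$. Then $d(M)\ge 1$.
   Context: Let $q$ be a power of a prime $p$, $K=\mathbb F_q((x))$ the field of formal Laurent series with its absolute value $|x|=q^{-1}$, and $\overline{K}_c$ the completion of an algebraic closure of $K$ with the extended absolute value. Put $[i]=x^{q^i}-x$ for $i\ge 1$. The Carlitz ring $\mathfrak A_1$ is the ring generated by $\tau$, $d_s$ and the scalars $\lambda\in\overline{K}_c$, with the relations $$d_s\tau-\tau d_s=[1]^{1/q},\qquad \tau\lambda=\lambda^q\tau,\qquad d_s\lambda=\lambda^{1/q}d_s .$$ Concretely, it is the ring of operators, on the set of $\mathbb F_q$-linear power series $f(s)=\sum_{m\ge 0} a_ms^{q^m}$ ($a_m\in\overline{K}_c$) converging near the origin, generated by $\tau f=f^q$, by the Carlitz derivative $d_sf(s)=\bigl(f(xs)-xf(s)\bigr)^{1/q}$, and by multiplications by scalars. Every element of $\mathfrak A_1$ is a finite sum $\sum c_{l,\mu}\tau^ld_s^\mu$ with $c_{l,\mu}\in\overline{K}_c$. Filtration: $\Gamma_\nu\subset\mathfrak A_1$ ($\nu\in\mathbb Z_+$) is the $\overline{K}_c$-vector space spanned by $\tau^ld_s^\mu$ with $l+\mu\le\nu$.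 The associated graded ring is $\mathrm{gr}(\mathfrak A_1)=\bigoplus_\nu\Gamma_\nu/\Gamma_{\nu-1}$ (with $\Gamma_{-1}=0$). A filtration of a left $\mathfrak A_1$-module $M$ is an increasing sequence $\mathfrak M_0\subset\mathfrak M_1\subset\cdots$ of finite-dimensional $\overline{K}_c$-subspaces with union $M$ and $\Gamma_\nu\mathfrak M_j\subset\mathfrak M_{\nu+j}$. It is good if $\bigoplus_j\mathfrak M_j/\mathfrak M_{j-1}$ (with $\mathfrak M_{-1}=0$) is a finitely generated $\mathrm{gr}(\mathfrak A_1)$-module. For a good filtration there is a polynomial $\chi\in\mathbb Q[t]$ with $\dim\mathfrak M_j=\chi(j)$ for all large $j$; the (Gelfand–Kirillov) dimension of $M$ is $d(M)=\deg\chi$, which does not depend on the choice of the good filtration. Here $\dim$ means dimension over $\overline{K}_c$. *)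

(* Defs.v *)
From HB Require Import structures.
From mathcomp Require Import all_boot all_order all_algebra.
From mathcomp Require Import all_classical all_reals ring.

Set Implicit Arguments.
Unset Strict Implicit.
Unset Printing Implicit Defensive.

Import Order.TTheory GRing.Theory Num.Theory.
Local Open Scope ring_scope.
Local Open Scope classical_set_scope.

Section PowerSeriesProduct.
Variable F : fieldType.
Implicit Types u v w : nat -> F.

Definition psmul u v k : F := \sum_(i < k.+1) u i * v (k - i)%N.

Lemma psmul_poly u v m k : (k < m)%N ->
  psmul u v k = ((\poly_(i < m) u i) * (\poly_(i < m) v i))`_k.
Proof.
move=> km; rewrite coefM; apply: eq_bigr => -[i /= ik] _.
rewrite !coef_poly (leq_ltn_trans _ km) //.
by rewrite (leq_ltn_trans (leq_subr _ _) km).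
Qed.

Lemma psmul_trunc u v m k : (k < m)%N ->
  (\poly_(i < m) psmul u v i)`_k = ((\poly_(i < m) u i) * (\poly_(i < m) v i))`_k.
Proof. by move=> km; rewrite coef_poly km (psmul_poly _ _ km). Qed.

Lemma psmulC u v k : psmul u v k = psmul v u k.
Proof. by rewrite !(@psmul_poly _ _ k.+1) // mulrC. Qed.

Lemma psmulA u v w k : psmul u (psmul v w) k = psmul (psmul u v) w k.
Proof.
rewrite !(@psmul_poly _ _ k.+1) //.
transitivity ((\poly_(i < k.+1) u i *
   (\poly_(i < k.+1) v i * \poly_(i < k.+1) w i))`_k).
  rewrite !coefM; apply: eq_bigr => -[i /= ik] _.
  by rewrite psmul_trunc // ltnS leq_subr.
rewrite mulrA !coefM; apply: eq_bigr => -[i /= ik] _.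
by rewrite psmul_trunc.
Qed.

Fixpoint psinv_seq u n : seq F :=
  if n is n'.+1 then let s := psinv_seq u n' in
    rcons s (((n' == 0%N)%:R - \sum_(i < n') u (n' - i)%N * s`_i) / u 0%N)
  else [::].

Lemma size_psinv_seq u n : size (psinv_seq u n) = n.
Proof. by elim: n => //= n IHn; rewrite size_rcons IHn. Qed.

Definition psinv u k : F := (psinv_seq u k.+1)`_k.

Lemma psinv_seqE u n k : (k < n)%N -> (psinv_seq u n)`_k = psinv u k.
Proof.
elim: n => // n IHn; rewrite ltnS leq_eqVlt => /orP[/eqP->//|kn].
by rewrite /= nth_rcons size_psinv_seq kn IHn.
Qed.

Lemma psmulV u k : u 0%N != 0 -> psmul (psinv u) u k = (k == 0%N)%:R.
Proof.
move=> u0; rewrite /psmul big_ord_recr /= subnn {2}/psinv /= nth_rcons.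
rewrite size_psinv_seq ltnn eqxx divfK // addrC.
rewrite (eq_bigr (fun i : 'I_k => psinv u i * u (k - i)%N)) ?subrK //.
by move=> i _; rewrite psinv_seqE // mulrC.
Qed.

End PowerSeriesProduct.

Definition lbounded (F : fieldType) (f : int -> F) (N : int) :=
  forall n, n < N -> f n = 0.

(* [laurent F] is F((x)): a series is its coefficient function int -> F, which
   vanishes below some index. *)
Record laurent (F : fieldType) := Laurent {
  lcoef :> int -> F;
  _ : `[< exists N, lbounded lcoef N >] }.

HB.instance Definition _ (F : fieldType) := [isSub for @lcoef F].
HB.instance Definition _ (F : fieldType) := [Choice of laurent F by <:].

Section LaurentTheory.
Variable F : fieldType.
Implicit Types f g h : laurent F.

Lemma laurentP f g : (forall n, f n = g n) -> f = g.
Proof. by move=> fg; apply/val_inj/funext. Qed.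

Lemma lbound f : exists N, lbounded f N.
Proof. exact/asboolP/(valP f). Qed.

Lemma lboundedW (f : int -> F) N M : M <= N -> lbounded f N -> lbounded f M.
Proof. by move=> MN fN n nM; apply: fN; apply: lt_le_trans MN. Qed.

Lemma lbound2 f g : exists2 N, lbounded f N & lbounded g N.
Proof.
have [N fN] := lbound f; have [M gM] := lbound g.
exists (Num.min N M); first by apply: lboundedW fN; rewrite ge_min lexx.
by apply: lboundedW gM; rewrite ge_min lexx orbT.
Qed.

Fact lzero_subproof : `[< exists N, lbounded (fun _ => 0 : F) N >].
Proof. by apply/asboolP; exists 0. Qed.
Definition lzero := Laurent lzero_subproof.

Fact lopp_subproof f : `[< exists N, lbounded (fun n => - f n) N >].
Proof.
by have [N fN] := lbound f; apply/asboolP; exists N => n nN; rewrite fN ?oppr0.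
Qed.
Definition lopp f := Laurent (lopp_subproof f).

Fact ladd_subproof f g : `[< exists N, lbounded (fun n => f n + g n) N >].
Proof.
have [N fN gN] := lbound2 f g; apply/asboolP; exists N => n nN.
by rewrite fN ?gN ?addr0.
Qed.
Definition ladd f g := Laurent (ladd_subproof f g).

Definition lmonom_fun (m n : int) : F := (n == m)%:R.
Fact lmonom_subproof m : `[< exists N, lbounded (lmonom_fun m) N >].
Proof.
by apply/asboolP; exists m => n nm; rewrite /lmonom_fun lt_eqF.
Qed.
Definition lmonom m := Laurent (lmonom_subproof m).

(* Convolution; the sum is over the finite support of i |-> f i * g (n - i). *)
Definition lmul_fun (f g : int -> F) (n : int) : F :=
  \sum_(i \in [set: int]) f i * g (n - i).

Lemma lmul_coef (f g : int -> F) N M k : lbounded f N -> lbounded g M ->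
  lmul_fun f g (N + M + k%:Z) =
  psmul (fun i => f (N + i%:Z)) (fun i => g (M + i%:Z)) k.
Proof.
move=> fN gM; rewrite /lmul_fun.
rewrite (fsbigE [seq N + i%:Z | i <- iota 0 k.+1]); first last.
- move=> i _ ni; have [iN|Ni] := ltP i N; first by rewrite fN ?mul0r.
  rewrite gM ?mulr0 //; rewrite ltNge; apply: contra ni => ikM.
  apply/mapP; exists `|i - N|%N; last by rewrite gez0_abs ?subr_ge0 // subrKC.
  rewrite mem_iota leq0n add0n ltnS -lez_nat gez0_abs ?subr_ge0 //.
  by move: ikM; rewrite lerBrDr [N + M]addrC -addrA lerD2l lerBlDl.
- by [].
- by rewrite map_inj_uniq ?iota_uniq // => i j /addrI [].
rewrite big_map (eq_bigl xpredT); last by move=> i; rewrite in_setT.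
rewrite -[k.+1]subn0 -/(index_iota 0 k.+1) big_mkord; apply: eq_bigr => -[i /= ik] _.
by congr (_ * g _); rewrite -subzn //; ring.
Qed.

Lemma lmul_bounded (f g : int -> F) N M : lbounded f N -> lbounded g M ->
  lbounded (lmul_fun f g) (N + M).
Proof.
move=> fN gM n nNM; apply: fsbig1 => i _.
have [iN|Ni] := ltP i N; first by rewrite fN ?mul0r.
by rewrite gM ?mulr0 // ltrBlDl (lt_le_trans nNM) // lerD2r.
Qed.

Fact lmul_subproof f g : `[< exists N, lbounded (lmul_fun f g) N >].
Proof.
have [N fN gN] := lbound2 f g; apply/asboolP; exists (N + N).
exact: lmul_bounded.
Qed.
Definition lmul f g := Laurent (lmul_subproof f g).

Lemma lbounded_ext (f g : int -> F) N : lbounded f N -> lbounded g N ->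
  (forall k : nat, f (N + k%:Z) = g (N + k%:Z)) -> f =1 g.
Proof.
move=> fN gN fg n; have [nN|Nn] := ltP n N; first by rewrite fN ?gN.
have -> : n = N + `|n - N|%N%:Z by rewrite gez0_abs ?subr_ge0 // subrKC.
exact: fg.
Qed.

Fact laddA : associative ladd.
Proof. by move=> f g h; apply: laurentP => n /=; rewrite addrA. Qed.
Fact laddC : commutative ladd.
Proof. by move=> f g; apply: laurentP => n /=; rewrite addrC. Qed.
Fact ladd0 : left_id lzero ladd.
Proof. by move=> f; apply: laurentP => n /=; rewrite add0r. Qed.
Fact laddN : left_inverse lzero lopp ladd.
Proof. by move=> f; apply: laurentP => n /=; rewrite addNr. Qed.

HB.instance Definition _ := GRing.isZmodule.Build (laurent F)
  laddA laddC ladd0 laddN.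

Fact lmulC : commutative lmul.
Proof.
move=> f g; have [N fN gN] := lbound2 f g; apply: laurentP.
by apply: (@lbounded_ext _ _ (N + N)) => [||k]; rewrite /= ?lmul_coef //;
  [exact: lmul_bounded|exact: lmul_bounded|exact: psmulC].
Qed.

Fact lmulA : associative lmul.
Proof.
move=> f g h; have [N fN] := lbound f; have [M gM] := lbound g.
have [L hL] := lbound h; apply: laurentP.
have fgb := lmul_bounded fN gM; have ghb := lmul_bounded gM hL.
apply: (@lbounded_ext _ _ (N + M + L)) => [||k] /=.
- by rewrite -addrA; exact: lmul_bounded.
- exact: lmul_bounded.
rewrite [RHS]lmul_coef // -[N + M + L]addrA [LHS]lmul_coef //.
have -> : (fun i => lmul_fun f g (N + M + i%:Z)) =
    psmul (fun i => f (N + i%:Z)) (fun i => g (M + i%:Z)).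
  by apply/funext => i; rewrite lmul_coef.
have -> : (fun i => lmul_fun g h (M + L + i%:Z)) =
    psmul (fun i => g (M + i%:Z)) (fun i => h (L + i%:Z)).
  by apply/funext => i; rewrite lmul_coef.
exact: psmulA.
Qed.

Lemma lmonom_bounded m : lbounded (lmonom m) m.
Proof. by move=> n nm; rewrite /= /lmonom_fun lt_eqF. Qed.

Fact lmul1 : left_id (lmonom 0) lmul.
Proof.
move=> f; have [N fN] := lbound f; apply: laurentP.
apply: (@lbounded_ext _ _ (0 + N)) => [||k] /=.
- by apply: lmul_bounded => //; exact: lmonom_bounded.
- by rewrite add0r.
rewrite lmul_coef //; last exact: lmonom_bounded.
rewrite /psmul big_ord_recl /= /lmonom_fun eqxx mul1r subn0 add0r.
by rewrite big1 ?addr0 // => i _; rewrite mul0r.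
Qed.

Fact lmulDl : left_distributive lmul ladd.
Proof.
move=> f g h; have [N fN gN] := lbound2 f g; have [M hM] := lbound h.
have fgN : lbounded (ladd f g) N by move=> n nN; rewrite /= fN ?gN ?addr0.
apply: laurentP; apply: (@lbounded_ext _ _ (N + M)) => [||k] /=.
- exact: lmul_bounded.
- by move=> n nN; rewrite !(lmul_bounded _ hM nN) ?addr0.
rewrite !lmul_coef // -big_split; apply: eq_bigr => i _ /=.
by rewrite mulrDl.
Qed.

Fact lone_neq0 : lmonom 0 != 0 :> laurent F.
Proof.
apply/eqP => /(congr1 (fun f : laurent F => f 0)) /eqP.
by rewrite /= /lmonom_fun eqxx oner_eq0.
Qed.

HB.instance Definition _ := GRing.Zmodule_isComNzRing.Build (laurent F)
  lmulA lmulC lmul1 lmulDl lone_neq0.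

Definition has_order f n := f n != 0 /\ lbounded f n.

Lemma ex_order f : f != 0 -> exists n, has_order f n.
Proof.
move=> f0; have [N fN] := lbound f.
have exk : exists k, f (N + k%:Z) != 0.
  apply: contrapT => nk; move/eqP: f0; apply; apply: laurentP.
  apply: (@lbounded_ext _ _ N) => // k; apply/eqP.
  by rewrite -[_ == _]negbK; apply/negP => fk; apply: nk; exists k.
case: (ex_minnP exk) => k fk kmin; exists (N + k%:Z); split => // n nk.
have [nN|Nn] := ltP n N; first by rewrite fN.
have nE : n = N + `|n - N|%N%:Z by rewrite gez0_abs ?subr_ge0 // subrKC.
apply/eqP; rewrite -[_ == _]negbK; apply/negP; rewrite {1}nE => /kmin.
by rewrite leqNgt -ltz_nat gez0_abs ?subr_ge0 // ltrBlDl nk.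
Qed.

Lemma ex_linv f : f != 0 -> exists g : laurent F, g * f = 1.
Proof.
move=> /ex_order[N [fN0 fN]]; pose w := psinv (fun i => f (N + i%:Z)).
pose gf (n : int) : F := if n < - N then 0 else w (absz (n + N)).
have gN : lbounded gf (- N) by move=> n nN; rewrite /gf nN.
have gP : `[< exists N, lbounded gf N >] by apply/asboolP; exists (- N).
exists (Laurent gP); apply: laurentP.
apply: (@lbounded_ext _ _ (- N + N)) => [||k] /=.
- exact: lmul_bounded.
- by rewrite addNr; exact: lmonom_bounded.
rewrite lmul_coef //.
have -> : (fun i => gf (- N + i%:Z)) = w.
  apply/funext => i; rewrite /gf ltNge lerDl le0z_nat /=.
  by rewrite addrAC addNr add0r.
by rewrite psmulV ?addr0 // addNr add0r.
Qed.

Definition linv f : laurent F :=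
  if f == 0 then 0 else xget 0 [set g | g * f = 1].

Fact lmulVf f : f != 0 -> linv f * f = 1.
Proof.
by move=> f0; rewrite /linv (negPf f0); exact: (xgetPex 0 (ex_linv f0)).
Qed.

Fact linv0 : linv 0 = 0.
Proof. by rewrite /linv eqxx. Qed.

HB.instance Definition _ := GRing.ComNzRing_isField.Build (laurent F)
  lmulVf linv0.

End LaurentTheory.

Record is_ultrametric_abs (R : realType) (C : fieldType) (abs : C -> R) : Prop := {
  uabs_ge0 : forall a, 0 <= abs a;
  uabs_eq0 : forall a, abs a = 0 <-> a = 0;
  uabsM : forall a b, abs (a * b) = abs a * abs b;
  uabsD : forall a b, abs (a + b) <= Num.max (abs a) (abs b) }.

Definition abs_cauchy (R : realType) (C : fieldType) (abs : C -> R) (u : nat -> C) :=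
  forall e, 0 < e -> exists N, forall m n, (N <= m)%N -> (N <= n)%N ->
    abs (u m - u n) < e.

Definition abs_cvg (R : realType) (C : fieldType) (abs : C -> R) (u : nat -> C) (l : C) :=
  forall e, 0 < e -> exists N, forall n, (N <= n)%N -> abs (u n - l) < e.

(* Kbar is an algebraic closure of K = F((x)) (iota is the inclusion), and C is
   the completion of Kbar (j is the inclusion) for the absolute value extending
   the one of K, i.e. |f| = q^(-n) when f has order n; in particular
   |x| = q^(-1). The extension of |.| to Kbar is unique because K is complete, so
   these conditions determine (C, abs) up to isometric isomorphism over K. *)
Record is_completed_closure (R : realType) (F : finFieldType)
    (Kbar : closedFieldType) (iota : {rmorphism laurent F -> Kbar})
    (C : fieldType) (j : {rmorphism Kbar -> C}) (abs : C -> R) : Prop := {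
  cc_algebraic : forall z, algebraicOver iota z;
  cc_abs : is_ultrametric_abs abs;
  cc_extends : forall f n, has_order f n -> abs (j (iota f)) = #|F|%:R ^ (- n);
  cc_complete : forall u, abs_cauchy abs u -> exists l, abs_cvg abs u l;
  cc_dense : forall c e, 0 < e -> exists z, abs (c - j z) < e }.

Section CarlitzRing.
Variables (C : fieldType) (q : nat) (x : C).

(* a^(1/q): when C is algebraically closed and q is a power of its
   characteristic, the q-th root exists and is unique. *)
Definition qroot (a : C) : C := xget 0 [set b | b ^+ q = a].

(* The Carlitz ring by generators and relations: formal ring expressions in tau,
   d_s and the scalars, modulo the smallest congruence [cequiv] that contains the
   ring axioms, makes [CScal] a ring morphism, and contains the three defining
   relations (the last three constructors), where [1] = x^q - x. *)
Inductive cexpr :=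
  | CScal of C | CTau | CDs
  | COpp of cexpr | CAdd of cexpr & cexpr | CMul of cexpr & cexpr.

HB.instance Definition _ := gen_eqMixin cexpr.
HB.instance Definition _ := gen_choiceMixin cexpr.

Inductive cequiv : cexpr -> cexpr -> Prop :=
  | ceq_refl a : cequiv a a
  | ceq_sym a b : cequiv a b -> cequiv b a
  | ceq_trans a b c : cequiv a b -> cequiv b c -> cequiv a c
  | ceq_opp a a' : cequiv a a' -> cequiv (COpp a) (COpp a')
  | ceq_add a a' b b' :
      cequiv a a' -> cequiv b b' -> cequiv (CAdd a b) (CAdd a' b')
  | ceq_mul a a' b b' :
      cequiv a a' -> cequiv b b' -> cequiv (CMul a b) (CMul a' b')
  | ceq_addA a b c : cequiv (CAdd a (CAdd b c)) (CAdd (CAdd a b) c)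
  | ceq_addC a b : cequiv (CAdd a b) (CAdd b a)
  | ceq_add0 a : cequiv (CAdd (CScal 0) a) a
  | ceq_addN a : cequiv (CAdd (COpp a) a) (CScal 0)
  | ceq_mulA a b c : cequiv (CMul a (CMul b c)) (CMul (CMul a b) c)
  | ceq_mul1l a : cequiv (CMul (CScal 1) a) a
  | ceq_mul1r a : cequiv (CMul a (CScal 1)) a
  | ceq_mulDl a b c : cequiv (CMul (CAdd a b) c) (CAdd (CMul a c) (CMul b c))
  | ceq_mulDr a b c : cequiv (CMul a (CAdd b c)) (CAdd (CMul a b) (CMul a c))
  | ceq_scalD l m : cequiv (CScal (l + m)) (CAdd (CScal l) (CScal m))
  | ceq_scalM l m : cequiv (CScal (l * m)) (CMul (CScal l) (CScal m))
  | ceq_ds_tau : cequiv (CAdd (CMul CDs CTau) (COpp (CMul CTau CDs)))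
                        (CScal (qroot (x ^+ q - x)))
  | ceq_tau_scal l : cequiv (CMul CTau (CScal l)) (CMul (CScal (l ^+ q)) CTau)
  | ceq_ds_scal l : cequiv (CMul CDs (CScal l)) (CMul (CScal (qroot l)) CDs).

Definition cequivb : rel cexpr := fun a b => `[< cequiv a b >].

Fact cequivb_equiv : equiv_class_of cequivb.
Proof.
split=> [a|a b|b a c].
- by apply/asboolP; exact: ceq_refl.
- by apply/asboolP/asboolP; exact: ceq_sym.
- by move=> /asboolP ab /asboolP bc; apply/asboolP; exact: ceq_trans ab bc.
Qed.

Canonical cequivb_equivrel := EquivRelPack cequivb_equiv.
Canonical cequivb_encModRel := defaultEncModRel cequivb.

Definition carlitz : Type := {eq_quot cequivb}%qT.

Local Open Scope quotient_scope.

HB.instance Definition _ := Choice.on carlitz.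
HB.instance Definition _ := EqQuotient.on carlitz.

Definition carlitz_pi (a : cexpr) : carlitz := \pi_carlitz a.

Lemma carlitz_piP a b : carlitz_pi a = carlitz_pi b <-> cequiv a b.
Proof.
by split=> [/eqP|ab]; [rewrite /carlitz_pi eqmodE => /asboolP|
  apply/eqP; rewrite /carlitz_pi eqmodE; exact/asboolP].
Qed.

Lemma carlitz_repr a : cequiv (repr (carlitz_pi a)) a.
Proof. by apply/carlitz_piP; rewrite /carlitz_pi reprK. Qed.

Lemma carlitz_ind (P : carlitz -> Prop) :
  (forall a, P (carlitz_pi a)) -> forall a, P a.
Proof. by move=> PI a; rewrite -[a]reprK; exact: PI. Qed.

Definition carlitz_opp (a : carlitz) := carlitz_pi (COpp (repr a)).
Definition carlitz_add (a b : carlitz) := carlitz_pi (CAdd (repr a) (repr b)).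
Definition carlitz_mul (a b : carlitz) := carlitz_pi (CMul (repr a) (repr b)).

Lemma carlitz_piN a : carlitz_opp (carlitz_pi a) = carlitz_pi (COpp a).
Proof. by apply/carlitz_piP/ceq_opp/carlitz_repr. Qed.
Lemma carlitz_piD a b :
  carlitz_add (carlitz_pi a) (carlitz_pi b) = carlitz_pi (CAdd a b).
Proof. by apply/carlitz_piP/ceq_add; exact/carlitz_repr. Qed.
Lemma carlitz_piM a b :
  carlitz_mul (carlitz_pi a) (carlitz_pi b) = carlitz_pi (CMul a b).
Proof. by apply/carlitz_piP/ceq_mul; exact/carlitz_repr. Qed.

Let piE := (carlitz_piN, carlitz_piD, carlitz_piM).

Fact carlitz_addA : associative carlitz_add.
Proof.
elim/carlitz_ind=> a; elim/carlitz_ind=> b; elim/carlitz_ind=> c.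
by rewrite !piE; apply/carlitz_piP/ceq_addA.
Qed.
Fact carlitz_addC : commutative carlitz_add.
Proof.
elim/carlitz_ind=> a; elim/carlitz_ind=> b.
by rewrite !piE; apply/carlitz_piP/ceq_addC.
Qed.
Fact carlitz_add0 : left_id (carlitz_pi (CScal 0)) carlitz_add.
Proof. by elim/carlitz_ind=> a; rewrite !piE; apply/carlitz_piP/ceq_add0. Qed.
Fact carlitz_addN :
  left_inverse (carlitz_pi (CScal 0)) carlitz_opp carlitz_add.
Proof. by elim/carlitz_ind=> a; rewrite !piE; apply/carlitz_piP/ceq_addN. Qed.

HB.instance Definition _ := GRing.isZmodule.Build carlitz
  carlitz_addA carlitz_addC carlitz_add0 carlitz_addN.

Fact carlitz_mulA : associative carlitz_mul.
Proof.
elim/carlitz_ind=> a; elim/carlitz_ind=> b; elim/carlitz_ind=> c.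
by rewrite !piE; apply/carlitz_piP/ceq_mulA.
Qed.
Fact carlitz_mul1l : left_id (carlitz_pi (CScal 1)) carlitz_mul.
Proof. by elim/carlitz_ind=> a; rewrite !piE; apply/carlitz_piP/ceq_mul1l. Qed.
Fact carlitz_mul1r : right_id (carlitz_pi (CScal 1)) carlitz_mul.
Proof. by elim/carlitz_ind=> a; rewrite !piE; apply/carlitz_piP/ceq_mul1r. Qed.
Fact carlitz_mulDl : left_distributive carlitz_mul +%R.
Proof.
elim/carlitz_ind=> a; elim/carlitz_ind=> b; elim/carlitz_ind=> c.
by rewrite /GRing.add /= !piE; apply/carlitz_piP/ceq_mulDl.
Qed.
Fact carlitz_mulDr : right_distributive carlitz_mul +%R.
Proof.
elim/carlitz_ind=> a; elim/carlitz_ind=> b; elim/carlitz_ind=> c.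
by rewrite /GRing.add /= !piE; apply/carlitz_piP/ceq_mulDr.
Qed.

HB.instance Definition _ := GRing.Zmodule_isPzRing.Build carlitz
  carlitz_mulA carlitz_mul1l carlitz_mul1r carlitz_mulDl carlitz_mulDr.

Definition scal (l : C) : carlitz := carlitz_pi (CScal l).
Definition tau : carlitz := carlitz_pi CTau.
Definition ds : carlitz := carlitz_pi CDs.

Fact scal_is_zmod_morphism : zmod_morphism scal.
Proof.
have scalD : {morph scal : l m / l + m}.
  by move=> l m; rewrite [RHS]piE; apply/carlitz_piP/ceq_scalD.
move=> l m; apply: (addIr (scal m)).
by rewrite -scalD !subrK.
Qed.
HB.instance Definition _ :=
  GRing.isZmodMorphism.Build C carlitz scal scal_is_zmod_morphism.

Fact scal_is_monoid_morphism : monoid_morphism scal.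
Proof.
by split=> // l m; rewrite [RHS]piE; apply/carlitz_piP/ceq_scalM.
Qed.
HB.instance Definition _ :=
  GRing.isMonoidMorphism.Build C carlitz scal scal_is_monoid_morphism.

Lemma ds_tau : ds * tau - tau * ds = scal (qroot (x ^+ q - x)).
Proof. by rewrite [X in X - _]piE [_ * _]piE [- _]piE [LHS]piE; apply/carlitz_piP/ceq_ds_tau. Qed.

Lemma tau_scal l : tau * scal l = scal (l ^+ q) * tau.
Proof. by rewrite [LHS]piE [RHS]piE; apply/carlitz_piP/ceq_tau_scal. Qed.

Lemma ds_scal l : ds * scal l = scal (qroot l) * ds.
Proof. by rewrite [LHS]piE [RHS]piE; apply/carlitz_piP/ceq_ds_scal. Qed.

End CarlitzRing.

Arguments scal {C q x}.
Arguments tau {C q x}.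
Arguments ds {C q x}.

Definition fin_gen (A : pzRingType) (M : lmodType A) :=
  exists n (g : 'I_n -> M), forall m, exists a : 'I_n -> A,
    m = \sum_(i < n) a i *: g i.

Record ring_filtration (A : pzRingType) := RingFiltration {
  rfil :> nat -> set A;
  rfil0 : forall n, rfil n 0;
  rfilB : forall n a b, rfil n a -> rfil n b -> rfil n (a - b);
  rfilS : forall n, rfil n `<=` rfil n.+1;
  rfil1 : rfil 0%N 1;
  rfilM : forall i j a b, rfil i a -> rfil j b -> rfil (i + j)%N (a * b) }.

Record mod_filtration (A : pzRingType) (G : ring_filtration A) (M : lmodType A) :=
  ModFiltration {
  mfil :> nat -> set M;
  mfil0 : forall n, mfil n 0;
  mfilB : forall n u v, mfil n u -> mfil n v -> mfil n (u - v);
  mfilS : forall n, mfil n `<=` mfil n.+1;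
  mfilZ : forall i j a u, G i a -> mfil j u -> mfil (i + j)%N (a *: u) }.

(* The associated graded ring and module. An element of the direct sum of the
   W_j / W_(j-1) (W_(-1) = 0) is a class of finitely supported families
   (u_j in W_j)_j modulo the families with u_j in W_(j-1) for all j. The action of
   gr(A) on gr(M) is induced by (a . u)_n = \sum_(i + j = n) a_i u_j, and gr(A) is
   the case M = A. *)
Section Graded.
Variables (A : pzRingType) (G : ring_filtration A).

Definition regular_filtration : mod_filtration G A^o :=
  @ModFiltration A G A^o G (@rfil0 _ G) (@rfilB _ G) (@rfilS _ G) (@rfilM _ G).

Section GradedModule.
Variables (M : lmodType A) (W : mod_filtration G M).

Lemma mfilN n u : W n u -> W n (- u).
Proof. by move=> Wu; rewrite -sub0r; apply: mfilB => //; exact: mfil0. Qed.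

Lemma mfilD n u v : W n u -> W n v -> W n (u + v).
Proof. by move=> Wu Wv; rewrite -[v]opprK; apply: mfilB => //; exact: mfilN. Qed.

Lemma mfil_sum n I (r : seq I) (P : pred I) (u : I -> M) :
  (forall i, P i -> W n (u i)) -> W n (\sum_(i <- r | P i) u i).
Proof.
by move=> Wu; elim/big_ind: _ => //; [exact: mfil0 | exact: mfilD].
Qed.

Definition mfil_prev n : set M := if n is n'.+1 then W n' else [set 0].

Record family := Family {
  fam :> nat -> M;
  _ : `[< (forall j, W j (fam j)) /\
          exists N, forall j, (N <= j)%N -> fam j = 0 >] }.

HB.instance Definition _ := [isSub for fam].
HB.instance Definition _ := [Choice of family by <:].

Lemma family_ext (f g : family) : fam f =1 fam g -> f = g.
Proof. by move=> fg; apply/val_inj/funext. Qed.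

Lemma family_fil (f : family) j : W j (f j).
Proof. by have /asboolP[] := valP f. Qed.

Lemma family_fin (f : family) : exists N, forall j, (N <= j)%N -> f j = 0.
Proof. by have /asboolP[] := valP f. Qed.

Fact family0_subproof : `[< (forall j, W j ((fun=> 0) j)) /\
  exists N, forall j, (N <= j)%N -> (fun=> 0 : M) j = 0 >].
Proof. by apply/asboolP; split; [move=> j; exact: mfil0|exists 0%N]. Qed.
Definition family0 := Family family0_subproof.

Fact familyN_subproof (f : family) : `[< (forall j, W j (- f j)) /\
  exists N, forall j, (N <= j)%N -> - f j = 0 >].
Proof.
apply/asboolP; split=> [j|]; first exact/mfilN/family_fil.
by have [N fN] := family_fin f; exists N => j /fN ->; rewrite oppr0.
Qed.
Definition familyN f := Family (familyN_subproof f).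

Fact familyD_subproof (f g : family) : `[< (forall j, W j (f j + g j)) /\
  exists N, forall j, (N <= j)%N -> f j + g j = 0 >].
Proof.
apply/asboolP; split=> [j|]; first by apply: mfilD; exact: family_fil.
have [N fN] := family_fin f; have [N' gN] := family_fin g.
exists (maxn N N') => j; rewrite geq_max => /andP[/fN -> /gN ->].
by rewrite addr0.
Qed.
Definition familyD f g := Family (familyD_subproof f g).

Fact familyDA : associative familyD.
Proof. by move=> f g h; apply: family_ext => j /=; rewrite addrA. Qed.
Fact familyDC : commutative familyD.
Proof. by move=> f g; apply: family_ext => j /=; rewrite addrC. Qed.
Fact family0D : left_id family0 familyD.
Proof. by move=> f; apply: family_ext => j /=; rewrite add0r. Qed.
Fact familyND : left_inverse family0 familyN familyD.
Proof. by move=> f; apply: family_ext => j /=; rewrite addNr. Qed.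

HB.instance Definition _ := GRing.isZmodule.Build family
  familyDA familyDC family0D familyND.

Definition family_low : pred family :=
  fun f => `[< forall j, mfil_prev j (f j) >].

Fact family_low_zmod_closed : zmod_closed family_low.
Proof.
split=> [|f g]; first by apply/asboolP => -[|j] //=; exact: mfil0.
move=> /asboolP fl /asboolP gl; apply/asboolP => j.
case: j (fl j) (gl j) => [|j] /=; last exact: mfilB.
by move=> f0 g0; change (f 0%N - g 0%N = 0); rewrite f0 g0 subr0.
Qed.

HB.instance Definition _ :=
  GRing.isZmodClosed.Build family family_low family_low_zmod_closed.

Definition gr : Type :=
  Quotient.quot (GRing.ZmodClosed.clone family family_low _).

HB.instance Definition _ := GRing.Zmodule.on gr.
HB.instance Definition _ := EqQuotient.on gr.

Definition gr_pi (f : family) : gr := \pi_gr%qT f.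

Lemma gr_piP f g : gr_pi f = gr_pi g <-> forall j, mfil_prev j (f j - g j).
Proof.
split=> [/eqP|fg]; last apply/eqP; rewrite /gr_pi -Quotient.idealrBE.
  by move=> /asboolP.
exact/asboolP.
Qed.

Lemma gr_piD f g : gr_pi (f + g) = gr_pi f + gr_pi g.
Proof. by rewrite /gr_pi !piE. Qed.

Lemma gr_ind (P : gr -> Prop) : (forall f, P (gr_pi f)) -> forall a, P a.
Proof. by move=> PI a; rewrite -[a]reprK; exact: PI. Qed.

Lemma gr_reprK a : gr_pi (repr a) = a.
Proof. exact: reprK. Qed.

Definition family_act_fun (a : nat -> A) (u : nat -> M) n : M :=
  \sum_(i < n.+1) a i *: u (n - i)%N.

End GradedModule.

Section GradedAction.
Variables (M : lmodType A) (W : mod_filtration G M).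
Local Notation rfamily := (family regular_filtration).

Fact family_act_subproof (a : rfamily) (u : family W) :
  `[< (forall j, W j (family_act_fun a u j)) /\
      exists N, forall j, (N <= j)%N -> family_act_fun a u j = 0 >].
Proof.
apply/asboolP; split=> [j|].
  apply: mfil_sum => -[i /= ij] _; rewrite -{1}(subnKC (ij : (i <= j)%N)).
  by apply: mfilZ; exact: family_fil.
have [N aN] := family_fin a; have [N' uN] := family_fin u.
exists (N + N')%N => j NN; apply: big1 => -[i /= ij] _.
have [Ni|iN] := leqP N i; first by rewrite aN // scale0r.
rewrite uN ?scaler0 // leq_subRL // (leq_trans _ NN) // leq_add2r.
exact: ltnW.
Qed.
Definition family_act a u : family W := Family (family_act_subproof a u).

Lemma family_act_lowl (a : rfamily) (u : family W) :
  (forall j, mfil_prev regular_filtration j (a j)) ->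
  forall j, mfil_prev W j (family_act a u j).
Proof.
move=> al [|j] /=.
  by rewrite /family_act_fun big_ord1 (al 0%N : a 0%N = 0) scale0r.
apply: mfil_sum => -[[|i] /= ij] _.
  by rewrite (al 0%N : a 0%N = 0) scale0r; exact: mfil0.
rewrite subSS -{1}(subnKC (ij : (i <= j)%N)).
by apply: mfilZ; [exact: (al i.+1)|exact: family_fil].
Qed.

Lemma family_act_lowr (a : rfamily) (u : family W) :
  (forall j, mfil_prev W j (u j)) ->
  forall j, mfil_prev W j (family_act a u j).
Proof.
move=> ul [|j] /=.
  by rewrite /family_act_fun big_ord1 (ul 0%N : u 0%N = 0) scaler0.
apply: mfil_sum => -[i /= ij] _; move: ij; rewrite ltnS leq_eqVlt => /orP[/eqP->|ij].
  by rewrite subnn (ul 0%N : u 0%N = 0) scaler0; exact: mfil0.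
rewrite subSn // -{1}(subnKC (ij : (i <= j)%N)).
by apply: mfilZ; [exact: family_fil|exact: (ul (j - i).+1)].
Qed.

Lemma family_actDl (a b : rfamily) (u : family W) :
  family_act (a + b) u = family_act a u + family_act b u.
Proof.
apply: family_ext => n; rewrite [RHS]/= /family_act_fun -big_split /=.
by apply: eq_bigr => i _; rewrite -scalerDl.
Qed.

Lemma family_actDr (a : rfamily) (u v : family W) :
  family_act a (u + v) = family_act a u + family_act a v.
Proof.
apply: family_ext => n; rewrite [RHS]/= /family_act_fun -big_split /=.
by apply: eq_bigr => i _; rewrite -scalerDr.
Qed.

Definition gr_act (a : gr regular_filtration) (u : gr W) : gr W :=
  gr_pi (family_act (repr a) (repr u)).

Lemma gr_actE a u : gr_act (gr_pi a) (gr_pi u) = gr_pi (family_act a u).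
Proof.
rewrite /gr_act; set a' := repr _; set u' := repr _.
have /gr_piP a'a : gr_pi a' = gr_pi a by exact: gr_reprK.
have /gr_piP u'u : gr_pi u' = gr_pi u by exact: gr_reprK.
transitivity (gr_pi (family_act a u')).
  apply/gr_piP => j.
  have -> : family_act a' u' j - family_act a u' j = family_act (a' - a) u' j.
    by rewrite -[a' in LHS](subrK a) family_actDl /= addrK.
  exact: family_act_lowl.
apply/gr_piP => j.
have -> : family_act a u' j - family_act a u j = family_act a (u' - u) j.
  by rewrite -[u' in LHS](subrK u) family_actDr /= addrK.
exact: family_act_lowr.
Qed.

Lemma gr_actDl a b u : gr_act (a + b) u = gr_act a u + gr_act b u.
Proof.
elim/gr_ind: a => a; elim/gr_ind: b => b; elim/gr_ind: u => u.
by rewrite -gr_piD !gr_actE -gr_piD family_actDl.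
Qed.

Lemma gr_actDr a u v : gr_act a (u + v) = gr_act a u + gr_act a v.
Proof.
elim/gr_ind: a => a; elim/gr_ind: u => u; elim/gr_ind: v => v.
by rewrite -gr_piD !gr_actE -gr_piD family_actDr.
Qed.

End GradedAction.

Local Notation rfamily := (family regular_filtration).

Fact family1_subproof : `[< (forall j, regular_filtration j ((j == 0%N)%:R : A)) /\
  exists N, forall j, (N <= j)%N -> ((j == 0%N)%:R : A) = 0 >].
Proof.
apply/asboolP; split=> [[|j]|]; [exact: rfil1|exact: rfil0|].
by exists 1%N => -[].
Qed.
Definition family1 : rfamily := @Family A^o regular_filtration _ family1_subproof.

Section GradedActionTheory.
Variables (M : lmodType A) (W : mod_filtration G M).

Lemma family_act1 (u : family W) : family_act family1 u = u.
Proof.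
apply: family_ext => n; rewrite /= /family_act_fun big_ord_recl /= scale1r subn0.
by rewrite big1 ?addr0 // => i _; rewrite scale0r.
Qed.

Lemma family_actA (a b : rfamily) (u : family W) :
  family_act a (family_act b u) = family_act (family_act a b) u.
Proof.
apply: family_ext => n; rewrite /= /family_act_fun.
transitivity (\sum_(0 <= i < n.+1) \sum_(i <= k < n.+1)
    ((a i : A) * (b (k - i)%N : A)) *: u (n - k)%N).
  rewrite big_mkord; apply: eq_bigr => -[i /= ij] _.
  rewrite -[X in index_iota X]add0n big_addn subSn // big_mkord scaler_sumr.
  by apply: eq_bigr => k _; rewrite scalerA addnK addnC subnDA.
rewrite (eq_bigr (fun i => \sum_(0 <= k < n.+1 | (i <= k)%N)
    ((a i : A) * (b (k - i)%N : A)) *: u (n - k)%N)); last first.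
  by move=> i _; rewrite (@big_nat_widenl _ _ _ i 0).
rewrite (exchange_big_dep_nat xpredT) //= big_mkord.
apply: eq_bigr => -[k /= kn] _; rewrite scaler_suml.
rewrite -(big_mkord xpredT
  (fun i => ((a i : A) * (b (k - i)%N : A)) *: u (n - k)%N)).
by rewrite (@big_nat_widen _ _ _ 0 k.+1 n.+1).
Qed.
End GradedActionTheory.

Fact gr_actA (M : lmodType A) (W : mod_filtration G M) a b (u : gr W) :
  gr_act a (gr_act b u) = gr_act (gr_act a b) u.
Proof.
elim/gr_ind: a => a; elim/gr_ind: b => b; elim/gr_ind: u => u.
by rewrite !gr_actE family_actA.
Qed.

Fact gr_act1 (M : lmodType A) (W : mod_filtration G M) (u : gr W) :
  gr_act (gr_pi family1) u = u.
Proof. by elim/gr_ind: u => u; rewrite gr_actE family_act1. Qed.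

Fact gr_act1r (a : gr regular_filtration) : gr_act a (gr_pi family1) = a.
Proof.
elim/gr_ind: a => a; rewrite gr_actE; congr gr_pi.
apply: family_ext => n; rewrite /= /family_act_fun big_ord_recr /= subnn.
rewrite [X in _ + X]mulr1 big1 ?add0r // => -[i /= ni] _.
by rewrite subn_eq0 leqNgt ni [LHS]mulr0.
Qed.

Definition gr_ring : Type := gr regular_filtration.

HB.instance Definition _ := GRing.Zmodule.on gr_ring.
HB.instance Definition _ := GRing.Zmodule_isPzRing.Build gr_ring
  (@gr_actA _ regular_filtration) (@gr_act1 _ regular_filtration) gr_act1r
  (@gr_actDl _ regular_filtration) (@gr_actDr _ regular_filtration).

HB.instance Definition _ (M : lmodType A) (W : mod_filtration G M) :=
  GRing.Zmodule_isLmodule.Build gr_ring (gr W)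
    (@gr_actA M W) (@gr_act1 M W) (@gr_actDr M W)
    (fun u a b => @gr_actDl M W a b u).

End Graded.

Section CarlitzModules.
Variables (C : fieldType) (q : nat) (x : C).
Local Notation A := (carlitz q x).

Definition Gamma (n : nat) : set A :=
  [set a | exists c : nat -> nat -> C,
    a = \sum_(l < n.+1) \sum_(m < n.+1 | (l + m <= n)%N)
          scal (c l m) * tau ^+ l * ds ^+ m].

Fact Gamma0 n : Gamma n 0.
Proof.
exists (fun _ _ => 0); rewrite big1 // => l _; rewrite big1 // => m _.
by rewrite rmorph0 !mul0r.
Qed.

Fact GammaB n a b : Gamma n a -> Gamma n b -> Gamma n (a - b).
Proof.
move=> [c ->] [d ->]; exists (fun l m => c l m - d l m); rewrite -sumrB.
apply: eq_bigr => l _; rewrite -sumrB; apply: eq_bigr => m _.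
by rewrite rmorphB !mulrBl.
Qed.

Lemma GammaD n a b : Gamma n a -> Gamma n b -> Gamma n (a + b).
Proof.
move=> Ga Gb; rewrite -[b]opprK; apply: GammaB => //.
by rewrite -sub0r; apply: GammaB => //; exact: Gamma0.
Qed.

Lemma Gamma_sum n I (r : seq I) (P : pred I) (F : I -> A) :
  (forall i, P i -> Gamma n (F i)) -> Gamma n (\sum_(i <- r | P i) F i).
Proof. by move=> GF; elim/big_ind: _ => //; [exact: Gamma0|exact: GammaD]. Qed.

Lemma Gamma_monom n c l m : (l + m <= n)%N ->
  Gamma n (scal c * tau ^+ l * ds ^+ m).
Proof.
move=> lmn; have ln : (l < n.+1)%N by rewrite ltnS (leq_trans (leq_addr m l)).
have mn : (m < n.+1)%N by rewrite ltnS (leq_trans (leq_addl l m)).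
exists (fun l' m' => if (l' == l) && (m' == m) then c else 0).
rewrite (bigD1 (Ordinal ln)) //= (bigD1 (Ordinal mn)) //= !eqxx /=.
rewrite big1 => [|m' /andP[_ m'm]]; last first.
  by rewrite -[m' == m :> nat]/(m' == Ordinal mn) (negPf m'm) rmorph0 !mul0r.
rewrite addr0 big1 ?addr0 // => l' l'l; rewrite big1 // => m' _.
by rewrite -[l' == l :> nat]/(l' == Ordinal ln) (negPf l'l) rmorph0 !mul0r.
Qed.

Fact GammaS n : Gamma n `<=` Gamma n.+1.
Proof.
move=> a [c ->]; apply: Gamma_sum => l _; apply: Gamma_sum => m lm.
by apply: Gamma_monom; exact: leqW.
Qed.

Lemma Gamma_le n m : (n <= m)%N -> Gamma n `<=` Gamma m.
Proof.
move=> /subnKC <-; elim: (m - n)%N => [|k IHk] a Ga; first by rewrite addn0.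
by rewrite addnS; apply/GammaS/IHk.
Qed.

Fact Gamma1 : Gamma 0 1.
Proof.
by have := @Gamma_monom 0 1 0 0 isT; rewrite rmorph1 !expr0 !mulr1.
Qed.

Lemma Gamma_scal n c a : Gamma n a -> Gamma n (scal c * a).
Proof.
move=> [d ->]; exists (fun l m => c * d l m); rewrite mulr_sumr.
apply: eq_bigr => l _; rewrite mulr_sumr; apply: eq_bigr => m _.
by rewrite rmorphM !mulrA.
Qed.

Lemma Gamma_tau n a : Gamma n a -> Gamma n.+1 (tau * a).
Proof.
move=> [c ->]; rewrite mulr_sumr; apply: Gamma_sum => l _.
rewrite mulr_sumr; apply: Gamma_sum => m lm.
rewrite !mulrA tau_scal -[scal _ * tau * _]mulrA -exprS.
by apply: Gamma_monom; rewrite addSn.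
Qed.

Lemma ds_tauX l : exists c, ds * tau ^+ l.+1 = tau ^+ l.+1 * ds + scal c * tau ^+ l :> A.
Proof.
pose c1 := qroot q (x ^+ q - x).
have ds_tau1 : ds * tau = tau * ds + scal c1 :> A by rewrite -ds_tau subrKC.
elim: l => [|l [c IHl]]; first by exists c1; rewrite !expr1 expr0 mulr1.
exists (c ^+ q + c1).
rewrite exprS mulrA ds_tau1 mulrDl -mulrA IHl mulrDr !mulrA -exprS tau_scal.
by rewrite -[scal (c ^+ q) * tau * _]mulrA -exprS -addrA -mulrDl -rmorphD.
Qed.

Lemma Gamma_ds n a : Gamma n a -> Gamma n.+1 (ds * a).
Proof.
move=> [c ->]; rewrite mulr_sumr; apply: Gamma_sum => -[l /= _] _.
rewrite mulr_sumr; apply: Gamma_sum => -[m /= _] lm.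
rewrite !mulrA ds_scal -[scal _ * ds * _]mulrA.
case: l lm => [|l] lm.
  rewrite expr0 mulr1 -mulrA -exprS -[scal _]mulr1 -(expr0 tau).
  exact: Gamma_monom.
have [c' ->] := ds_tauX l; rewrite mulrDr mulrDl; apply: GammaD.
  by rewrite mulrA -[_ * ds ^+ m]mulrA -exprS; apply: Gamma_monom; rewrite addnS.
rewrite mulrA -rmorphM; apply: Gamma_monom.
by apply: leqW; apply: leq_trans lm; rewrite leq_add2r.
Qed.

Fact GammaM i j a b : Gamma i a -> Gamma j b -> Gamma (i + j)%N (a * b).
Proof.
move=> [c ->] Gb; rewrite mulr_suml; apply: Gamma_sum => l _.
rewrite mulr_suml; apply: Gamma_sum => m lm; rewrite -!mulrA.
apply/Gamma_scal/(@Gamma_le (l + (m + j))); first by rewrite addnA leq_add2r.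
have : Gamma (m + j)%N (ds ^+ m * b).
  elim: (m : nat) => [|k IHk]; first by rewrite expr0 mul1r.
  by rewrite exprS -mulrA; exact: Gamma_ds.
elim: (l : nat) => [|k IHk] G'; first by rewrite expr0 mul1r.
by rewrite exprS -mulrA; exact/Gamma_tau/IHk.
Qed.

Definition Gamma_filtration : ring_filtration A :=
  RingFiltration Gamma0 GammaB GammaS Gamma1 GammaM.

(* The C-linear structure of an A-module is its restriction of scalars along
   [scal]. *)
Definition has_dim (M : lmodType A) (V : set M) (n : nat) :=
  exists b : 'I_n -> M,
    (forall c : 'I_n -> C, \sum_(i < n) scal (c i) *: b i = 0 ->
      forall i, c i = 0) /\
    V = [set u | exists c : 'I_n -> C, u = \sum_(i < n) scal (c i) *: b i].

Record filtration (M : lmodType A) := Filtration {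
  fil :> mod_filtration Gamma_filtration M;
  fil_dim : forall j, exists n, has_dim (fil j) n;
  fil_union : forall u, exists j, fil j u }.

Definition good_filtration (M : lmodType A) (W : filtration M) :=
  @fin_gen (gr_ring Gamma_filtration) (gr W).

Definition hilbert_poly (M : lmodType A) (W : filtration M) (chi : {poly rat}) :=
  exists N, forall j, (N <= j)%N ->
    exists2 n, has_dim (W j) n & chi.[j%:R] = n%:R.

(* [gk_dim M d] is d(M) = d; [size chi = d.+1] says that chi has degree d. *)
Definition gk_dim (M : lmodType A) (d : nat) :=
  exists2 W : filtration M, good_filtration W &
    exists2 chi, hilbert_poly W chi & size chi = d.+1.

End CarlitzModules.

(* Main.v *)
Require Import Defs.
From HB Require Import structures.
From mathcomp Require Import all_boot all_order all_algebra.
From mathcomp Require Import all_classical all_reals.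
From mathcomp Require Import abelian finfield.

Import Order.TTheory GRing.Theory Num.Theory.
Local Open Scope ring_scope.
Local Open Scope classical_set_scope.

Set Implicit Arguments.
Unset Strict Implicit.
Unset Printing Implicit Defensive.

(** Existence of modules of every finite dimension.  On the row space C^k let tau
    act by u |-> u^q and d_s by u |-> mu u^(1/q), coordinatewise.  These maps are
    semilinear in the way the relations of the Carlitz ring prescribe, and
    d_s tau - tau d_s is multiplication by mu - mu^q, so they define a module as
    soon as mu - mu^q = [1]^(1/q) (row_rep).  This Artin-Schreier equation has
    its coefficients in the algebraically closed field Kbar, hence a solution
    there.  The q-th root must be additive and multiplicative on all of C, which
    amounts to C being perfect: C is the completion of a perfect field, and the
    q-power map raises distances to the power q, so q-th roots pass to limits
    (complete_closure_perfect).  A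
    module of finite dimension k > 0 has the constant filtration, which is good
    and has the constant k as Hilbert polynomial (gk_dim_finite).

    Vacuum vectors.  Although tau and d_s are only semilinear, T = tau d_s is
    linear over C.  If d_s v = 0, then tau^m v is an eigenvector of T with
    eigenvalue [m] = x^(q^m) - x (vacuum_eigen).  Since 0 < |x| < 1, these
    eigenvalues are pairwise distinct, so all the tau^m v are linearly
    independent when none of them vanishes.  The spaces of any filtration of the
    module therefore have unbounded dimension (vacuum_has_dim), and a Hilbert
    polynomial cannot be constant. *)

(** * The q-power map in characteristic p *)

Lemma expB_pchar (S : comNzRingType) (q : nat) (a b : S) :
  [pchar S].-nat q -> (a - b) ^+ q = a ^+ q - b ^+ q.
Proof. by move=> qS; rewrite exprDn_pchar // exprNn_pchar. Qed.

Lemma expI_pchar (S : idomainType) (q : nat) :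
  [pchar S].-nat q -> injective (fun a : S => a ^+ q).
Proof.
move=> qS a b /eqP; rewrite -subr_eq0 -expB_pchar // expf_eq0 subr_eq0.
by case/andP=> _ /eqP.
Qed.

Lemma laurent_mulrn (F : fieldType) (f : laurent F) n i : (f *+ n) i = f i *+ n.
Proof. by elim: n => [|n IHn]; rewrite ?mulr0n // !mulrS -IHn. Qed.

Lemma laurent_pchar (F : fieldType) p : p \in [pchar F] -> p \in [pchar (laurent F)].
Proof.
move=> pF; rewrite inE (pcharf_prime pF) /=; apply/eqP/laurentP => i.
by rewrite laurent_mulrn (mulrn_pchar pF).
Qed.

Lemma pnat_pchar_card (F : finFieldType) (C : fieldType)
  (h : {rmorphism laurent F -> C}) : [pchar C].-nat #|F|.
Proof.
have [p pr_p pF] := finPcharP F.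
have pC : p \in [pchar C] by apply/(rmorph_pchar h)/laurent_pchar.
rewrite (eq_pnat _ (pcharf_eq pC)) -cardsT.
exact: (abelem_pgroup (fin_ring_pchar_abelem pF)).
Qed.

(** * Roots in the completion of an algebraically closed field *)

Section Ultrametric.
Variables (R : realType) (C : fieldType) (abs : C -> R).
Hypothesis absP : is_ultrametric_abs abs.

Lemma uabs1 : abs 1 = 1.
Proof.
have a1 : abs 1 != 0.
  by apply/eqP => /(uabs_eq0 absP)/eqP; rewrite oner_eq0.
by apply: (mulfI a1); rewrite -(uabsM absP) !mulr1.
Qed.

Lemma uabsX a n : abs (a ^+ n) = abs a ^+ n.
Proof. by elim: n => [|n IHn]; rewrite ?expr0 ?uabs1 // !exprS (uabsM absP) IHn. Qed.

Lemma uabsN a : abs (- a) = abs a.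
Proof.
have /eqP : abs (- 1) ^+ 2 = 1 by rewrite -uabsX sqrrN expr1n uabs1.
rewrite sqrf_eq1 => /orP[] /eqP aN1; first by rewrite -mulN1r (uabsM absP) aN1 mul1r.
by have := uabs_ge0 absP (-1); rewrite aN1 oppr_ge0 ler10.
Qed.

Lemma uabsC a b : abs (a - b) = abs (b - a).
Proof. by rewrite -uabsN opprB. Qed.

Lemma uabs_trans b a c e : abs (a - b) < e -> abs (b - c) < e -> abs (a - c) < e.
Proof.
move=> ab bc; rewrite -[a](subrK b) -addrA.
by apply: le_lt_trans (uabsD absP _ _) _; rewrite gt_max ab bc.
Qed.

Lemma uabs_eq a b : (forall e, 0 < e -> abs (a - b) < e) -> a = b.
Proof.
move=> abe; apply/eqP; rewrite -subr_eq0; apply/eqP/(uabs_eq0 absP).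
apply/eqP; rewrite eq_le uabs_ge0 // andbT leNgt; apply/negP => /abe.
by rewrite ltxx.
Qed.

(** In characteristic p, |a^q - b^q| = |a - b|^q.  Hence if c is a limit of
    elements of the dense field K, q-th roots of these elements in K form a
    Cauchy sequence, and their limit is a q-th root of c. *)
Lemma complete_closure_perfect (K : closedFieldType) (j : {rmorphism K -> C}) q :
    (forall u, abs_cauchy abs u -> exists l, abs_cvg abs u l) ->
    (forall c e, 0 < e -> exists z, abs (c - j z) < e) ->
    [pchar C].-nat q -> forall c : C, exists b, b ^+ q = c.
Proof.
move=> complete dense qC c; have q_gt0 : (0 < q)%N by case/andP: qC.
have /choice[w wc] (n : nat) : exists w, abs (c - j w ^+ q) < n.+1%:R^-1.
  have [z cz] := dense c n.+1%:R^-1 ltac:(by rewrite invr_gt0 ltr0Sn).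
  have [w] := solve_monicpoly (fun i => if i == 0%N then z else 0) q_gt0.
  case: (q) q_gt0 => // q' _; rewrite big_ord_recl big1 => [|i _]; last first.
    by rewrite mul0r.
  by rewrite mulr1 addr0 => wz; exists w; rewrite -rmorphXn wz.
have wcE e : 0 < e ->
    exists N, forall n, (N <= n)%N -> abs (c - j (w n) ^+ q) < e.
  move=> /ltr_add_invr[N]; rewrite add0r => Ne; exists N => n Nn.
  apply: lt_trans (wc n) (le_lt_trans _ Ne).
  by rewrite lef_pV2 ?posrE ?ltr0Sn // ler_nat.
have distX a b e : 0 < e -> (abs (a - b) < e) = (abs (a ^+ q - b ^+ q) < e ^+ q).
  move=> e0; rewrite -expB_pchar // uabsX ltr_pXn2r ?nnegrE ?(ltW e0) //.
  exact: uabs_ge0.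
have [|l wl] := complete (fun n => j (w n)).
  move=> e e0; have [N wN] := wcE (e ^+ q) (exprn_gt0 _ e0).
  exists N => m n Nm Nn; rewrite distX //.
  by apply: (uabs_trans (b := c)); [rewrite uabsC|]; exact: wN.
exists l; apply: uabs_eq => e e0.
have e1 : 0 < Num.min e 1 by rewrite lt_min e0 ltr01.
have [N wN] := wl _ e1; have [N' wN'] := wcE _ e0.
apply: (uabs_trans (b := j (w (maxn N N')) ^+ q)); last first.
  by rewrite uabsC wN' // leq_maxr.
have lw : abs (l - j (w (maxn N N'))) < Num.min e 1.
  by rewrite uabsC wN // leq_maxl.
rewrite distX // in lw; apply: lt_le_trans lw _.
(* e ^+ q may exceed e when e > 1, whence the minimum with 1. *)
rewrite (le_trans (y := Num.min e 1)) ?ge_min ?lexx //.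
by rewrite -[leRHS]expr1 ler_wiXn2l ?ge_min ?lexx ?orbT // ltW.
Qed.

End Ultrametric.

Section Qroot.
Variables (C : fieldType) (q : nat).
Hypothesis qC : [pchar C].-nat q.

Lemma qrootK_ex (a : C) : (exists b, b ^+ q = a) -> qroot q a ^+ q = a.
Proof. by move=> ex_b; exact: (xgetPex 0 ex_b). Qed.

Lemma qroot_exp (b : C) : qroot q (b ^+ q) = b.
Proof. by apply: (expI_pchar qC); rewrite qrootK_ex //; exists b. Qed.

Hypothesis C_perfect : forall a : C, exists b, b ^+ q = a.

Lemma qrootK (a : C) : qroot q a ^+ q = a.
Proof. exact: qrootK_ex. Qed.

Lemma qrootM : {morph @qroot C q : a b / a * b}.
Proof. by move=> a b; rewrite -{1}[a]qrootK -{1}[b]qrootK -exprMn qroot_exp. Qed.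

Lemma qrootD : {morph @qroot C q : a b / a + b}.
Proof.
by move=> a b; rewrite -{1}[a]qrootK -{1}[b]qrootK -exprDn_pchar // qroot_exp.
Qed.

End Qroot.

(** * Modules from pairs of semilinear maps *)

Record carlitz_rep (C : fieldType) (q : nat) (x : C) (V : lmodType C)
    (t d : V -> V) : Prop := {
  rep_tD : {morph t : u v / u + v};
  rep_dD : {morph d : u v / u + v};
  rep_tZ : forall a u, t (a *: u) = a ^+ q *: t u;
  rep_dZ : forall a u, d (a *: u) = qroot q a *: d u;
  rep_dt : forall u, d (t u) - t (d u) = qroot q (x ^+ q - x) *: u }.

Section ModuleOfRep.
Variables (C : fieldType) (q : nat) (x : C) (V : lmodType C) (t d : V -> V).
Hypothesis rep : carlitz_rep q x t d.

Fixpoint ceval (e : cexpr C) : V -> V :=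
  match e with
  | CScal a => fun u => a *: u
  | CTau => t
  | CDs => d
  | COpp e1 => fun u => - ceval e1 u
  | CAdd e1 e2 => fun u => ceval e1 u + ceval e2 u
  | CMul e1 e2 => fun u => ceval e1 (ceval e2 u)
  end.

(** The two semilinear maps are additive, so every ring expression acts
    additively; right distributivity in the Carlitz ring relies on it. *)
Lemma cevalD e : {morph ceval e : u v / u + v}.
Proof.
elim: e => [a|||e1 IH1|e1 IH1 e2 IH2|e1 IH1 e2 IH2] u v /=.
- exact: scalerDr.
- exact: (rep_tD rep).
- exact: (rep_dD rep).
- by rewrite IH1 opprD.
- by rewrite IH1 IH2 addrACA.
- by rewrite IH2 IH1.
Qed.

Lemma ceval_equiv e1 e2 : cequiv q x e1 e2 -> ceval e1 =1 ceval e2.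
Proof.
elim=> {e1 e2} /=.
- by [].
- by move=> a b _ IH u; rewrite IH.
- by move=> a b c _ IH1 _ IH2 u; rewrite IH1.
- by move=> a b _ IH u /=; rewrite IH.
- by move=> a a' b b' _ IH1 _ IH2 u /=; rewrite IH1 IH2.
- by move=> a a' b b' _ IH1 _ IH2 u /=; rewrite IH1 IH2.
- by move=> a b c u /=; rewrite addrA.
- by move=> a b u /=; rewrite addrC.
- by move=> a u /=; rewrite scale0r add0r.
- by move=> a u /=; rewrite addNr scale0r.
- by [].
- by move=> a u /=; rewrite scale1r.
- by move=> a u /=; rewrite scale1r.
- by [].
- by move=> a b c u /=; rewrite cevalD.
- by move=> a b u /=; rewrite scalerDl.
- by move=> a b u /=; rewrite scalerA.
- by move=> u /=; rewrite (rep_dt rep).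
- by move=> a u /=; rewrite (rep_tZ rep).
- by move=> a u /=; rewrite (rep_dZ rep).
Qed.

Local Notation A := (carlitz q x).

Definition carlitz_act (a : A) (u : V) : V := ceval (repr a) u.

Lemma carlitz_actE e u : carlitz_act (carlitz_pi q x e) u = ceval e u.
Proof. exact/ceval_equiv/carlitz_repr. Qed.

Fact carlitz_actA a b u : carlitz_act a (carlitz_act b u) = carlitz_act (a * b) u.
Proof.
elim/carlitz_ind: a => a; elim/carlitz_ind: b => b.
by rewrite [_ * _]carlitz_piM !carlitz_actE.
Qed.

Fact carlitz_act1 u : carlitz_act 1 u = u.
Proof. by rewrite carlitz_actE /= scale1r. Qed.

Fact carlitz_actDr a u v :
  carlitz_act a (u + v) = carlitz_act a u + carlitz_act a v.
Proof. exact: cevalD. Qed.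

Fact carlitz_actDl u a b :
  carlitz_act (a + b) u = carlitz_act a u + carlitz_act b u.
Proof.
elim/carlitz_ind: a => a; elim/carlitz_ind: b => b.
by rewrite [_ + _]carlitz_piD !carlitz_actE.
Qed.

(** The proof [rep] is bound to the type so that the module structure below
    can be inferred from it. *)
Definition rep_module : Type := let _ := rep in V.

HB.instance Definition _ := GRing.Zmodule.on rep_module.
HB.instance Definition _ := GRing.Zmodule_isLmodule.Build A rep_module
  carlitz_actA carlitz_act1 carlitz_actDr carlitz_actDl.

Lemma rep_module_scal (a : C) (u : rep_module) :
  (scal a : A) *: u = (a *: (u : V) : V).
Proof. exact: carlitz_actE. Qed.

End ModuleOfRep.

(** * Finite-dimensional modules *)

Section FiniteDimensional.
Variables (C : fieldType) (q : nat) (x : C).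
Local Notation A := (carlitz q x).
Local Notation G := (Gamma_filtration q x).
Variable (M : lmodType A).

Definition const_mod_filtration : mod_filtration G M :=
  @ModFiltration A G M (fun=> setT) (fun=> I) (fun _ _ _ _ _ => I)
    (fun _ _ _ => I) (fun _ _ _ _ _ _ => I).

Section Degree0.
Variables (N : lmodType A) (W : mod_filtration G N).

Fact family_in0_subproof u (Wu : W 0%N u) :
  `[< (forall j, W j (if j == 0%N then u else 0)) /\
      exists n, forall j, (n <= j)%N -> (if j == 0%N then u else 0) = 0 >].
Proof.
apply/asboolP; split=> [[|j]|] //=; first exact: mfil0.
by exists 1%N => -[].
Qed.
Definition family_in0 u (Wu : W 0%N u) := Family (family_in0_subproof Wu).

Lemma gr_pi_sum n (f : 'I_n -> Defs.family W) :
  gr_pi (\sum_i f i) = \sum_i gr_pi (f i).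
Proof.
elim/big_ind2: _ => // [|a b c d <- <-]; last exact: gr_piD.
by apply: (addrI (gr_pi 0)); rewrite -gr_piD !addr0.
Qed.

Lemma fam_sum n (f : 'I_n -> Defs.family W) i : (\sum_j f j) i = \sum_j f j i.
Proof. by elim/big_ind2: _ => // a b c d <- <-. Qed.

End Degree0.

Variable (k : nat).
Hypothesis Mk : has_dim [set: M] k.

Definition const_filtration : filtration M :=
  @Filtration C q x M const_mod_filtration (fun=> ex_intro _ k Mk)
    (fun u => ex_intro _ 0%N I).

Lemma scal_Gamma0 (c : C) : regular_filtration G 0%N (scal c : A).
Proof. by have := @Gamma_monom C q x 0 c 0 0 isT; rewrite !expr0 !mulr1. Qed.

(** The graded module of the constant filtration is M in degree 0, hence is
    generated by a basis of M over the scalars, which are in degree 0 too. *)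
Lemma const_filtration_good : good_filtration const_filtration.
Proof.
have [b [_ bM]] := Mk.
pose W := const_mod_filtration.
exists k, (fun i => gr_pi (@family_in0 M W (b i) I) : gr const_filtration).
elim/gr_ind => f.
have : [set: M] (f 0%N) by [].
rewrite bM => -[c fc].
exists (fun i => gr_pi (family_in0 (scal_Gamma0 (c i))) : gr_ring G).
rewrite (eq_bigr (fun i => gr_pi (family_act (family_in0 (scal_Gamma0 (c i)))
   (@family_in0 M W (b i) I)))); last by move=> i _; exact: gr_actE.
rewrite -(gr_pi_sum (W := W)); apply/gr_piP => -[|i] //=.
rewrite fam_sum fc; apply/eqP; rewrite subr_eq0; apply/eqP/eq_bigr => i _.
by rewrite /= /family_act_fun big_ord1.
Qed.

Lemma gk_dim_finite : (0 < k)%N -> gk_dim M 0.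
Proof.
move=> k0; exists const_filtration; first exact: const_filtration_good.
exists (k%:R)%:P; last by rewrite size_polyC pnatr_eq0 -lt0n k0.
by exists 0%N => i _; exists k => //; rewrite hornerC.
Qed.

End FiniteDimensional.

Section Cartesian.
Variables (C : fieldType) (q : nat) (x mu : C) (k : nat).
Hypotheses (qC : [pchar C].-nat q) (C_perfect : forall a : C, exists b, b ^+ q = a).
Hypothesis mu_eq : mu - mu ^+ q = qroot q (x ^+ q - x).

Definition row_tau (u : 'rV[C]_k) := map_mx (fun a => a ^+ q) u.
Definition row_ds (u : 'rV[C]_k) := map_mx (fun a => mu * qroot q a) u.

(** The root undoes the power in d_s tau u = mu u, while tau d_s u = mu^q u: the
    commutator is the scalar mu - mu^q, which explains the equation on mu. *)
Lemma row_rep : carlitz_rep q x row_tau row_ds.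
Proof.
split=> [u v|u v|a u|a u|u]; apply/rowP => i; rewrite !mxE.
- exact: exprDn_pchar.
- by rewrite qrootD // mulrDr.
- exact: exprMn.
- by rewrite qrootM // mulrCA.
- by rewrite qroot_exp // exprMn qrootK // -mulrBl mu_eq.
Qed.

Lemma row_dim : has_dim [set: rep_module row_rep] k.
Proof.
have sumE (c : 'I_k -> C) : \sum_(i < k) (scal (c i) : carlitz q x) *:
    (delta_mx 0 i : rep_module row_rep) = (\row_i c i : 'rV[C]_k).
  rewrite [RHS]row_sum_delta; apply: eq_bigr => i _.
  by rewrite rep_module_scal mxE.
exists (fun i => delta_mx 0 i : 'rV[C]_k); split=> [c c0 i|].
  by move: c0; rewrite sumE => /rowP/(_ i); rewrite !mxE.
apply/seteqP; split=> // u _; exists (fun i => (u : 'rV[C]_k) 0 i).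
by rewrite sumE; apply/rowP => i; rewrite mxE.
Qed.

End Cartesian.

(** * Vacuum vectors *)

Section Vacuum.
Variables (C : fieldType) (q : nat) (x : C).
Local Notation A := (carlitz q x).
Variable (M : lmodType A).

Lemma scal_eq0 (a : C) (u : M) : (scal a : A) *: u = 0 -> u <> 0 -> a = 0.
Proof.
move=> au0 u0; apply/eqP/negPn/negP => a0; apply: u0.
by rewrite -[u]scale1r -(rmorph1 scal) -(mulVf a0) rmorphM -scalerA au0 scaler0.
Qed.

(** T - e_n kills u_n and multiplies each other u_i by a nonzero scalar, which
    turns a relation between u_0, ..., u_n into one between u_0, ..., u_(n-1). *)
Lemma eigenvectors_free (T : A) (e : nat -> C) (u : nat -> M) (n : nat)
    (c : nat -> C) :
    (forall a, T * scal a = scal a * T) ->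
    (forall m, T *: u m = scal (e m) *: u m) -> injective e ->
    (forall m, u m <> 0) ->
    \sum_(i < n) (scal (c i) : A) *: u i = 0 -> forall i, (i < n)%N -> c i = 0.
Proof.
move=> Tlin Tu e_inj u0; elim: n c => [|n IHn] c // sum0.
have cn i : (i < n)%N -> c i = 0.
  move=> ltin; pose c' i := (e i - e n) * c i.
  have /(IHn c')/(_ i ltin)/eqP : \sum_(i < n) (scal (c' i) : A) *: u i = 0.
    transitivity ((T - scal (e n)) *: (\sum_(i < n.+1) (scal (c i) : A) *: u i)).
      rewrite scaler_sumr big_ord_recr /= [X in _ + X](_ : _ = 0) ?addr0.
        apply: eq_bigr => k _.
        rewrite scalerA mulrBl Tlin scalerBl -scalerA Tu scalerA -!rmorphM.
        by rewrite -scalerBl -rmorphB /c' mulrC mulrBr [c k * e n]mulrC.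
      rewrite scalerA mulrBl Tlin scalerBl -scalerA Tu scalerA -!rmorphM.
      by rewrite mulrC subrr.
    by rewrite sum0 scaler0.
  rewrite mulf_eq0 subr_eq0 => /orP[/eqP/e_inj eq_in|/eqP//].
  by rewrite eq_in ltnn in ltin.
move=> i; rewrite ltnS leq_eqVlt => /orP[/eqP->|]; last exact: cn.
move: sum0; rewrite big_ord_recr big1 /= => [|k _].
  by rewrite add0r => /scal_eq0; apply.
by rewrite cn // rmorph0 scale0r.
Qed.

Lemma has_dim_free_le (V : set M) n m (u : nat -> M) :
    has_dim V n -> (forall i, (i < m)%N -> V (u i)) ->
    (forall c : nat -> C, \sum_(i < m) (scal (c i) : A) *: u i = 0 ->
      forall i, (i < m)%N -> c i = 0) ->
  (m <= n)%N.
Proof.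
move=> [b [_ ->]] Vu u_free.
have /choice[f fE] (i : 'I_m) : exists c : 'I_n -> C,
    u i = \sum_(j < n) (scal (c j) : A) *: b j by exact: Vu.
pose B := \matrix_(i < m, j < n) f i j.
suff : row_free B by rewrite -row_leq_rank => /leq_trans; apply; exact: rank_leq_col.
apply/inj_row_free => w wB.
have sumE : \sum_(i < m) (scal (w 0 i) : A) *: u i = 0.
  rewrite (eq_bigr (fun i => \sum_(j < n) (scal (w 0 i * B i j) : A) *: b j)).
    rewrite exchange_big big1 // => j _; rewrite -scaler_suml -rmorph_sum.
    have /rowP/(_ j) := wB; rewrite !mxE => ->.
    by rewrite rmorph0 scale0r.
  move=> i _; rewrite fE scaler_sumr; apply: eq_bigr => j _.
  by rewrite scalerA -rmorphM mxE.
pose c i := if insub i is Some i' then w 0 i' else 0.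
have cE (i : 'I_m) : c i = w 0 i.
  by rewrite /c insubT // => lt_im; congr (w 0 _); exact: val_inj.
apply/rowP => i; rewrite mxE -cE; apply: u_free => //.
by rewrite -[RHS]sumE; apply: eq_bigr => k _; rewrite cE.
Qed.

Hypotheses (qC : [pchar C].-nat q) (C_perfect : forall a : C, exists b, b ^+ q = a).

(** With T = tau d_s one has T tau = tau T + [1] tau, so the eigenvalues obey
    e_(m+1) = e_m^q + [1], that is e_m = [m]. *)
Lemma vacuum_eigen (v : M) m : (ds : A) *: v = 0 ->
  (tau * ds : A) *: (tau ^+ m *: v) = (scal (x ^+ (q ^ m) - x) : A) *: (tau ^+ m *: v).
Proof.
move=> dv; elim: m => [|m IHm].
  by rewrite !expr0 expr1 subrr rmorph0 scale0r scale1r -scalerA dv scaler0.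
have TtE : tau * ds * tau = tau * (tau * ds) + scal (x ^+ q - x) * tau :> A.
  rewrite -mulrA -[ds * tau](subrK (tau * ds)) ds_tau mulrDr tau_scal.
  by rewrite qrootK // addrC.
rewrite exprS -[(tau * tau ^+ m) *: v]scalerA; move: (tau ^+ m *: v) IHm => u IHm.
rewrite scalerA TtE scalerDl -scalerA IHm !scalerA tau_scal -scalerDl -mulrDl -rmorphD.
by rewrite expB_pchar // -exprM -expnSr addrA subrK.
Qed.

(** The first n vectors tau^m v are independent and lie in a common step of the
    filtration, which can be taken beyond any N. *)
Lemma vacuum_has_dim (W : filtration M) (v : M) (N : nat) :
    injective (fun m => x ^+ (q ^ m)) ->
    ds *: v = 0 -> (forall m, tau ^+ m *: v <> 0) ->
  forall n, exists2 i, (N <= i)%N & forall d, has_dim (W i) d -> (n <= d)%N.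
Proof.
move=> x_inj dv tv0 n.
have W_le i k : (i <= k)%N -> W i `<=` W k.
  move=> /subnKC <-; elim: (k - i)%N => [|l IHl] u Wu; first by rewrite addn0.
  by rewrite addnS; apply/mfilS/IHl.
have /choice[f fW] m : exists i, W i (tau ^+ m *: v) by exact: fil_union.
pose i := (N + \sum_(m < n) f m)%N; exists i; first exact: leq_addr.
move=> d Wd; apply: (has_dim_free_le (u := fun m => tau ^+ m *: v) Wd) => [m mn|c].
  by apply: W_le (fW m); rewrite /i (bigD1 (Ordinal mn)) //= addnCA leq_addr.
apply: (@eigenvectors_free (tau * ds) (fun m => x ^+ (q ^ m) - x)
  (fun m => tau ^+ m *: v) n c) => //.
- by move=> a; rewrite -mulrA ds_scal !mulrA tau_scal qrootK.
- by move=> m; exact: vacuum_eigen.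
- by move=> m m' /addIr/x_inj.
Qed.

End Vacuum.

Theorem theorem1 (R : realType) (F : finFieldType) (Kbar : closedFieldType)
    (iota : {rmorphism laurent F -> Kbar}) (C : fieldType)
    (j : {rmorphism Kbar -> C}) (abs : C -> R)
    (hC : is_completed_closure iota j abs) :
  let A := carlitz #|F| (j (iota (lmonom F 1))) in
  (forall k : nat, (0 < k)%N ->
    exists M : lmodType A,
      [/\ exists u : M, u <> 0, has_dim [set: M] k & gk_dim M 0]) /\
  (forall M : lmodType A,
    fin_gen M ->
    (exists W : filtration M, good_filtration W) ->
    forall v : M, ds *: v = 0 -> (forall m : nat, tau ^+ m *: v <> 0) ->
    forall d : nat, gk_dim M d -> (1 <= d)%N).
Proof.
set q := #|F|; set x' := iota _; set x := j x' => A.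
have qC : [pchar C].-nat q by exact: (pnat_pchar_card (j \o iota)).
have absP := cc_abs hC.
have C_perfect : forall a : C, exists b, b ^+ q = a.
  exact: (complete_closure_perfect absP (cc_complete hC) (cc_dense hC) qC).
have q_gt1 : (1 < q)%N by exact: finNzRing_gt1.
split=> [k k_gt0|M _ _ v dv tv0 [|d] // [W _ [chi [N Nchi] chi1]]].
  (* Kbar is algebraically closed by hypothesis, so both equations are solved
     there and their solutions carried to C by j. *)
  have [c c_root] : exists c : Kbar, c ^+ q = x' ^+ q - x'.
    have [c cE] := solve_monicpoly
      (fun i => if i == 0%N then x' ^+ q - x' else 0) (ltnW q_gt1).
    exists c; rewrite cE; case: (q) q_gt1 => // q' _.
    rewrite big_ord_recl mulr1 big1 ?addr0 // => i _; exact: mul0r.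
  have [mu mu_root] : exists mu : Kbar, mu - mu ^+ q = c.
    have [mu muE] := solve_monicpoly
      (fun i => if i == 0%N then - c else (i == 1%N)%:R) (ltnW q_gt1).
    exists mu; rewrite muE; case: (q) q_gt1 => // -[//|q'] _.
    rewrite !big_ord_recl big1 => [|i _]; last exact: mul0r.
    by rewrite mulr1 addr0 mul1r opprD opprK addrCA subrr addr0.
  have mu_eq : j mu - j mu ^+ q = qroot q (x ^+ q - x).
    apply: (expI_pchar qC); rewrite qrootK // -rmorphXn -rmorphB mu_root.
    by rewrite -rmorphXn c_root rmorphB rmorphXn.
  pose rep := row_rep k qC C_perfect mu_eq.
  exists (rep_module rep); split; [|exact: row_dim|].
    exists (const_mx 1 : 'rV[C]_k) => /matrixP/(_ 0 (Ordinal k_gt0))/eqP.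
    by rewrite !mxE oner_eq0.
  exact: gk_dim_finite (row_dim k qC C_perfect mu_eq) k_gt0.
have x_inj : injective (fun m => x ^+ (q ^ m)).
  have xq : abs x = q%:R^-1.
    have -> : q%:R^-1 = #|F|%:R ^ (- 1%:Z) :> R by rewrite exprN1.
    apply: (cc_extends hC); split; last exact: lmonom_bounded.
    by rewrite /= /lmonom_fun eqxx oner_eq0.
  have q_gt1R : 1 < q%:R :> R by rewrite ltr1n.
  have x_gt0 : 0 < abs x by rewrite xq invr_gt0 (lt_trans ltr01).
  have x_neq1 : abs x != 1 by rewrite xq invr_eq1 gt_eqF.
  move=> m n /(congr1 abs); rewrite !(uabsX absP) => /(ieexprIn x_gt0 x_neq1).
  exact: expnI.
have /eqP/size_poly1P[c _ chiE] := chi1.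
have [d0 _ cd0] := Nchi N (leqnn N).
have [i Ni Wi] := vacuum_has_dim qC C_perfect W N x_inj dv tv0 d0.+1.
have [d Wd cd] := Nchi i Ni.
have := Wi d Wd; suff -> : d = d0 by rewrite ltnn.
by apply/eqP; rewrite -(eqr_nat rat) -cd -cd0 chiE !hornerC.
Qed.
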